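(* Let $\mathbb{K}$ be a field, let $k\geq 3$, and let $X\subset\mathbb{P}^{k-1}$ be a finite set of $n$ distinct $\mathbb{K}$-rational points, not all contained in a hyperplane (so $\alpha(X)\geq 2$). Let $a$ be an integer with $1\leq a\leq \alpha(X)-1$. Set $$\beta_a:=\binom{\alpha(X)-1-a+k-1}{k-1},\qquad \beta_a':=(k-1)(\alpha(X)-1-a)+1.$$ Then $\beta_a=\beta_a'$ when $\alpha(X)\in\{a+1,a+2\}$, and $\beta_a>\beta_a'$ when $\alpha(X)\geq a+3$.
   Context: $R=\mathbb{K}[x_1,\ldots,x_k]$ is the polynomial ring with the standard grading. For a finite set of $\mathbb{K}$-rational points $X\subset\mathbb{P}^{k-1}$, $I(X)\subset R$ is its (homogeneous) defining ideal, i.e. the ideal generated by all forms vanishing at every point of $X$. The initial degree $\alpha(X)$ is the smallest degree of a nonzero element of $I(X)$. *)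

(* Defs.v *)
From HB Require Import structures.
From mathcomp Require Import all_boot all_order all_algebra finmap.
From mathcomp Require Import boolp mpoly.

Set Implicit Arguments.
Unset Strict Implicit.
Unset Printing Implicit Defensive.

Import GRing.Theory.
Local Open Scope ring_scope.

(* A K-rational point of P^(k-1) is a line of K^k through the origin, so that
   equality of points is Leibniz equality, with no choice of representative. *)
Definition proj_point (K : fieldType) (k : nat) : Type :=
  {P : {vspace 'rV[K]_k} | \dim P == 1%N}.

HB.instance Definition _ (K : fieldType) (k : nat) :=
  Choice.copy (proj_point K k) {P : {vspace 'rV[K]_k} | \dim P == 1%N}.

Section Points.
Variables (K : fieldType) (k : nat).
Implicit Types (X : {fset proj_point K k}) (P : proj_point K k).
Implicit Types (p f : {mpoly K[k]}).

Definition vanishes_at f P : Prop :=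
  forall v : 'rV[K]_k, v \in val P -> f.@[fun i => v ord0 i] = 0.

Definition is_form f : Prop := exists d : nat, f \is d.-homog.

Definition vanishing_form X f : Prop :=
  is_form f /\ forall P, P \in X -> vanishes_at f P.

(* p is in the ideal generated by S; a pair is a (coefficient, generator). *)
Definition in_ideal_gen (S : {mpoly K[k]} -> Prop) p : Prop :=
  exists2 s : seq ({mpoly K[k]} * {mpoly K[k]}),
    (forall qf, qf \in s -> S qf.2) & p = \sum_(qf <- s) qf.1 * qf.2.

Definition defining_ideal X : {mpoly K[k]} -> Prop :=
  in_ideal_gen (vanishing_form X).

(* For p != 0 the total degree of p is (msize p).-1. *)
Definition ideal_degree X (d : nat) : Prop :=
  exists p, [/\ defining_ideal X p, p != 0 & (msize p).-1 = d].

Lemma ex_ideal_degreeb X :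
  (exists d, ideal_degree X d) -> exists d, `[< ideal_degree X d >].
Proof. by case=> d dP; exists d; apply/asboolP. Qed.

(* The default value 0 is never used when 1 < k, see [initial_degreeP]. *)
Definition initial_degree X : nat :=
  if pselect (exists d, ideal_degree X d) is left h
  then ex_minn (ex_ideal_degreeb h) else 0%N.

Definition hyperplane (H : {vspace 'rV[K]_k}) : Prop := \dim H = (k - 1)%N.

Definition in_hyperplane X : Prop :=
  exists2 H, hyperplane H & forall P, P \in X -> (val P <= H)%VS.

Lemma linear_form_at P : (1 < k)%N ->
  exists2 f : {mpoly K[k]}, f != 0 & f \is 1.-homog /\ vanishes_at f P.
Proof.
case: P => U /= dU k_gt1.
have [u U_line] : exists u, U = <[u]>%VS.
  exists (vpick U); apply/esym/eqP; rewrite eqEdim -memvE memv_pick (eqP dU).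
  by rewrite dim_vline vpick0 -dimv_eq0 (eqP dU).
have u_neq0 : u != 0.
  by apply: contraTneq dU => u0; rewrite U_line u0 dim_vline eqxx.
have [i ui] : exists i, u ord0 i != 0.
  apply/existsP; apply: contraNT u_neq0; rewrite negb_exists => /forallP u0.
  by apply/eqP/rowP => i; rewrite mxE; apply/eqP; rewrite -[_ == _]negbK u0.
have [j ji] : exists j : 'I_k, j != i.
  apply/existsP; apply: contraTT k_gt1; rewrite negb_exists -leqNgt => /forallP e.
  rewrite -[k in (k <= _)%N]card_ord -(card1 i) subset_leq_card //.
  by apply/subsetP => j _; rewrite inE -[_ == _]negbK e.
exists (u ord0 i *: 'X_j - u ord0 j *: 'X_i).
  apply/eqP => /(congr1 (mcoeff U_(j)%MM)).
  rewrite mcoeffB !mcoeffZ !mcoeffX eqxx mcoeff0 mulr1.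
  rewrite eq_mnm1 [i == j]eq_sym (negPf ji) mulr0 subr0 => /eqP.
  by rewrite (negPf ui).
split; first by rewrite rpredB ?rpredZ ?dhomogX /= ?mdeg1.
move=> v /=; rewrite U_line => /vlineP[c ->].
rewrite mevalB !mevalZ !mevalXU !mxE.
by rewrite mulrCA [u ord0 j * (_ * _)]mulrCA [u ord0 j * _]mulrC subrr.
Qed.

Lemma ex_ideal_degree X : (1 < k)%N -> exists d, ideal_degree X d.
Proof.
move=> k_gt1.
suff [f [f0 [[d fd] fX]]] : exists f, f != 0 /\ vanishing_form X f.
  exists (msize f).-1, f; split=> //.
  exists [:: (1, f)]; last by rewrite big_seq1 mul1r.
  by move=> qf; rewrite inE => /eqP ->; split=> //; exists d.
suff [f [f0 ff fX]] : exists f, [/\ f != 0, is_form f &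
    forall P, P \in enum_fset X -> vanishes_at f P].
  by exists f.
elim: (enum_fset X) => [|P s [f [f0 [d fd] fs]]].
  by exists 1; split=> //; [exact: oner_neq0 | exists 0%N; exact: dhomog1].
have [l l0 [l1 lP]] := linear_form_at P k_gt1.
exists (l * f); split; first by rewrite mulf_neq0.
  by exists (1 + d)%N; apply: dhomogM.
move=> Q; rewrite inE => /orP[/eqP ->|Qs] v vQ; rewrite mevalM.
  by rewrite lP ?mul0r.
by rewrite (fs _ Qs) ?mulr0.
Qed.

Lemma initial_degreeP X : (1 < k)%N ->
  ideal_degree X (initial_degree X) /\
  (forall d, ideal_degree X d -> (initial_degree X <= d)%N).
Proof.
move=> k_gt1; rewrite /initial_degree; case: pselect => [h|]; last first.
  by case; exact: ex_ideal_degree.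
case: ex_minnP => d /asboolP dX dmin; split=> // e eX.
by apply: dmin; apply/asboolP.
Qed.

Lemma defining_ideal_vanishes X p P :
  defining_ideal X p -> P \in X -> vanishes_at p P.
Proof.
case=> s sX -> PX v vP; rewrite raddf_sum big_seq big1 // => qf qfs.
rewrite /= mevalM (proj2 (sX _ qfs) P PX v vP) mulr0 //.
Qed.

Lemma hyperplane_lker (A : 'cV[K]_k) : A != 0 ->
  hyperplane (lker (linfun (mulmxr A : 'rV[K]_k -> 'rV[K]_1))).
Proof.
move=> A0; set h := linfun _; have := limg_ker_dim h fullv.
rewrite capfv => dk.
have dM : \dim {: 'rV[K]_k} = k by rewrite dimvf dim_matrix [LHS]mul1n.
suff d1 : \dim (h @: fullv) = 1%N by rewrite /hyperplane -[in RHS]dM -dk d1 addnK.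
apply/eqP; rewrite eqn_leq; apply/andP; split.
  by apply: leq_trans (dimvS (subvf _)) _; rewrite dimvf dim_matrix.
rewrite lt0n dimv_eq0; apply: contraNneq A0 => h0.
apply/eqP/row_matrixP => i; rewrite row0 rowE.
have := memv_img h (memvf (delta_mx 0 i : 'rV[K]_k)).
by rewrite h0 memv0 lfunE => /eqP.
Qed.

Lemma initial_degree_ge2 X : (1 < k)%N -> ~ in_hyperplane X ->
  (2 <= initial_degree X)%N.
Proof.
move=> k_gt1 Xn; have [[p [pX p0 <-]] _] := initial_degreeP X k_gt1.
rewrite leqNgt; apply/negP => degp; apply: Xn.
have p_le1 m : m \in msupp p -> (mdeg m <= 1)%N.
  by move/msize_mdeg_lt => /leq_trans; move: degp; case: (msize p) => [|[|[]]] //=;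
     move=> _ /(_ 2) /(_ isT).
have {p_le1}pE : p = p@_0%MM *: 'X_[0%MM] + \sum_i p@_U_(i) *: 'X_i.
  apply/mpolyP => m; rewrite mcoeffD raddf_sum /= mcoeffZ mcoeffX.
  under eq_bigr => i _ do rewrite mcoeffZ mcoeffX.
  have [/p_le1|mp] := boolP (m \in msupp p); last first.
    rewrite (memN_msupp_eq0 mp) big1 => [|i _].
      by case: eqP => [->|_]; rewrite ?(memN_msupp_eq0 mp) ?mulr0 ?mul0r addr0.
    by case: eqP => [->|_]; rewrite ?(memN_msupp_eq0 mp) ?mulr0 ?mul0r.
  rewrite leq_eqVlt ltnS leqn0 mdeg_eq1 mdeg_eq0.
  case/orP => [/existsP[i /eqP ->]|/eqP ->].
    rewrite (bigD1 i) //= eqxx mulr1 eq_sym mnm1_eq0 mulr0 add0r big1 ?addr0 //.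
    by move=> j /negPf ji; rewrite eq_mnm1 ji mulr0.
  by rewrite eqxx mulr1 big1 ?addr0 // => i _; rewrite mnm1_eq0 mulr0.
pose A : 'M[K]_(k, 1) := \col_i p@_U_(i).
pose h := linfun (mulmxr A : 'rV[K]_k -> 'rV[K]_1).
have hE (v : 'rV[K]_k) : p.@[fun i => v ord0 i] = p@_0%MM + h v ord0 ord0.
  rewrite {1}pE mevalD mevalZ mevalX big1 => [|i _]; last by rewrite mnm0E.
  rewrite mulr1 raddf_sum lfunE /= mxE; congr (_ + _); apply: eq_bigr => i _.
  by rewrite mevalZ mevalXU !mxE mulrC.
have [X0|[P0 P0X]] := fset_0Vmem X.
  exists (lker (linfun (mulmxr (const_mx 1 : 'cV[K]_k) : 'rV[K]_k -> 'rV[K]_1))).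
    apply: hyperplane_lker; apply/eqP => /matrixP /(_ (Ordinal k_gt1) 0).
    by rewrite !mxE => /eqP; rewrite oner_eq0.
  by move=> P; rewrite X0 inE.
have c0 : p@_0%MM = 0.
  have := defining_ideal_vanishes pX P0X (mem0v _).
  by rewrite hE linear0 mxE addr0.
exists (lker h).
  apply: hyperplane_lker; apply: contraNneq p0 => A0.
  rewrite pE c0 scale0r add0r big1 // => i _.
  by have /matrixP/(_ i 0) := A0; rewrite !mxE => ->; rewrite scale0r.
move=> P PX; apply/subvP => v vP; rewrite memv_ker.
have := defining_ideal_vanishes pX PX vP; rewrite hE c0 add0r => hv.
by apply/eqP/matrixP => i j; rewrite !ord1 hv mxE.
Qed.

End Points.

(* Natural-number subtraction is truncated, so these are the intended values
   only for 1 <= a <= alpha - 1 and 1 <= k. *)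
Definition beta (alpha k a : nat) : nat :=
  'C(alpha - 1 - a + k - 1, k - 1)%N.

Definition beta' (alpha k a : nat) : nat := ((k - 1) * (alpha - 1 - a) + 1)%N.

(* Main.v *)
Require Import Defs.
From mathcomp Require Import all_boot all_order all_algebra finmap.
From mathcomp Require Import zify.

(** Put [m = k - 1] and [t = alpha - 1 - a]. By Pascal's rule the increment of ['C(t + m, m)] in [t] is
    ['C(t + m, m - 1)], which is at least the slope [m] of [m * t + 1], and
    larger than [m] as soon as [1 <= t] and [2 <= m]. *)

(** The binomial grows with its upper index, so [t = 0] is the smallest case; there Pascal's rule
    gives ['C(m.+2, m.+1) = m.+2] plus the positive ['C(m.+2, m)]. *)
Lemma bin_step_gt (m t : nat) : m.+2 < 'C(t.+1 + m.+2, m.+1).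
Proof.
apply: (@leq_trans 'C(m.+3, m.+1)); last by apply: leq_bin2l; lia.
by rewrite binS binSn -[X in X < _]addn0 ltn_add2l bin_gt0; lia.
Qed.

Lemma linear_lt_bin (m t : nat) : m.+2 * t.+2 + 1 < 'C(t.+2 + m.+2, m.+2).
Proof.
elim: t => [|t IHt]; rewrite addSn binS.
  (* With 1 in place of [t.+2] both sides equal [m.+3], so one strict step settles the value 2. *)
  by have := bin_step_gt m 0; rewrite !add1n binSn; lia.
by have := bin_step_gt m t.+1; lia.
Qed.

Theorem proposition3p6 (K : fieldType) (k : nat) (hk : (3 <= k)%N)
    (n : nat) (X : {fset proj_point K k}) (hn : #|` X|%fset = n)
    (hX : ~ in_hyperplane X)
    (a : nat) (ha : (1 <= a <= initial_degree X - 1)%N) :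
  (initial_degree X = (a + 1)%N \/ initial_degree X = (a + 2)%N ->
    beta (initial_degree X) k a = beta' (initial_degree X) k a) /\
  ((a + 3 <= initial_degree X)%N ->
    (beta' (initial_degree X) k a < beta (initial_degree X) k a)%N).
Proof.
move: (initial_degree X) => d; rewrite /beta /beta'.
have [m ->] : exists m, k = m.+3 by exists (k - 3); lia.
have -> : m.+3 - 1 = m.+2 by lia.
split=> [[] -> | le_d].
- have -> : a + 1 - 1 - a = 0 by lia.
  have -> : 0 + m.+3 - 1 = m.+2 by lia.
  by rewrite binn muln0.
- have -> : a + 2 - 1 - a = 1 by lia.
  have -> : 1 + m.+3 - 1 = m.+3 by lia.
  by rewrite binSn muln1 addn1.
(* The gap [d - 1 - a] is at least 2; at 0 and 1 the two sides agree. *)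
have [t ->] : exists t, d - 1 - a = t.+2 by exists (d - a - 3); lia.
have -> : t.+2 + m.+3 - 1 = t.+2 + m.+2 by lia.
exact: linear_lt_bin.
Qed.
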